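(* Let $k\geq 3$ and $n\geq 3$. Let $X_k(n-1)$ be any set of edges of $B_k(n-1)$ obtained as the union of $E_k(n-1)$ with the edge sets of exactly one circuit from each reverse-complementary pair of non-negasymmetric circuits in $\mathcal{C}_k(n-1)$. Then: (i) the subgraph of $B_k(n-1)$ with edge set $X_k(n-1)$ and vertex set the vertices of non-zero in-degree is Eulerian (connected, with every vertex having in-degree equal to out-degree); (ii) the subgraph of $B_k(n-1)$ with edge set $X_k(n-1)$ is antinegasymmetric.
   Context: Tuples are $k$-ary, i.e. have entries in $\mathbb{Z}_k=\{0,1,\dots,k-1\}$; negation is modulo $k$. For $\mathbf{u}=(u_0,\dots,u_{n-1})$ write $\mathbf{u}^R=(u_{n-1},\dots,u_0)$ and $-\mathbf{u}=(-u_0,\dots,-u_{n-1})$. The pseudoweight of $a\in\mathbb{Z}_k$ is $w^*(a)=a$ (as an integer) if $a\neq 0$ and $w^*(0)=k/2$; the pseudoweight of a tuple is the sum of the pseudoweights of its entries. The de Bruijn digraph $B_k(n-1)$ has as vertices all $k$-ary $(n-1)$-tuples and, for each $k$-ary $n$-tuple $(a_0,\dots,a_{n-1})$, an edge (identified with that $n$-tuple) from $(a_0,\dots,a_{n-2})$ to $(a_1,\dots,a_{n-1})$. $E_k(n-1)$ is the set of edges of pseudoweight less than $kn/2$, and $H_k(n-1)$ is the subgraph of $B_k(n-1)$ whose edges are those of pseudoweight exactly $kn/2$. For an $n$-tuple $(a_0,\dots,a_{n-1})$, let $m$ be the least positive integer $c$ with $a_i=a_{(i+c)\bmod n}$ for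 all $0\le i<n$; $[a_0,\dots,a_{n-1}]$ denotes the circuit in $B_k(n-1)$ whose edges are the $m$ cyclic shifts $(a_j,a_{j+1},\dots,a_{j+n-1})$ (indices mod $n$), $0\le j<m$; $m$ is its period. $\mathcal{C}_k(n-1)$ is the set of all circuits $[a_0,\dots,a_{n-1}]$ with $(a_0,\dots,a_{n-1})$ an edge of $H_k(n-1)$. A circuit is negasymmetric if it contains edges $\mathbf{a},\mathbf{b}$ (not necessarily distinct) with $\mathbf{a}=-\mathbf{b}^R$, and non-negasymmetric otherwise. If $[a_0,\dots,a_{n-1}]\in\mathcal{C}_k(n-1)$ is non-negasymmetric, then $[-a_{n-1},-a_{n-2},\dots,-a_0]$ is a different non-negasymmetric circuit in $\mathcal{C}_k(n-1)$; such a pair of circuits is called a reverse-complementary pair, and the non-negasymmetric circuits of $\mathcal{C}_k(n-1)$ are partitioned into such pairs. A set (or subgraph) of edges is antinegasymmetric if $\mathbf{a}\neq-\mathbf{b}^R$ for every pair of edges $\mathbf{a},\mathbf{b}$ in it (including $\mathbf{a}=\mathbf{b}$). *)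

(* Defs.v *)
From mathcomp Require Import all_boot all_order all_algebra.

Set Implicit Arguments.
Unset Strict Implicit.
Unset Printing Implicit Defensive.

Import Order.TTheory GRing.Theory Num.Theory.
Local Open Scope ring_scope.

(* Finite directed multigraphs: an edge e goes from src e to tgt e, and a
   subgraph is given by its vertex set W and its edge set X. *)

Definition indeg (V E : finType) (tgt : E -> V) (X : {set E}) (v : V) : nat :=
  #|[set e in X | tgt e == v]|.

Definition outdeg (V E : finType) (src : E -> V) (X : {set E}) (v : V) : nat :=
  #|[set e in X | src e == v]|.

Definition is_subgraph (V E : finType) (src tgt : E -> V)
    (W : {set V}) (X : {set E}) : Prop :=
  forall e, e \in X -> (src e \in W) /\ (tgt e \in W).

(* Adjacency in the underlying undirected graph. *)
Definition adjacent (V E : finType) (src tgt : E -> V) (X : {set E}) : rel V :=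
  [rel u v | [exists e in X, ((src e == u) && (tgt e == v))
                          || ((src e == v) && (tgt e == u))]].

Definition connected (V E : finType) (src tgt : E -> V)
    (W : {set V}) (X : {set E}) : Prop :=
  forall u v, u \in W -> v \in W -> connect (adjacent src tgt X) u v.

Definition Eulerian (V E : finType) (src tgt : E -> V)
    (W : {set V}) (X : {set E}) : Prop :=
  [/\ is_subgraph src tgt W X,
      connected src tgt W X
    & forall v, v \in W -> indeg tgt X v = outdeg src X v].

(* The tuples are indexed by n and k with 'Z_k as alphabet, which is Z/kZ only
   for k >= 2.  The edges of the de Bruijn digraph B_k(n-1) are the n-tuples
   and its vertices the (n-1)-tuples. *)

Definition dB_src (k n : nat) (a : n.-tuple 'Z_k) : (n.-1).-tuple 'Z_k :=
  [tuple tnth a (widen_ord (leq_pred n) i) | i < n.-1].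

Definition dB_tgt (k n : nat) (a : n.-tuple 'Z_k) : (n.-1).-tuple 'Z_k :=
  [tuple of behead a].

Definition negrev (k n : nat) (a : n.-tuple 'Z_k) : n.-tuple 'Z_k :=
  [tuple of map -%R (rev a)].

Definition pseudoweight1 (k : nat) (a : 'Z_k) : rat :=
  if a == 0 then k%:R / 2 else (nat_of_ord a)%:R.

Definition pseudoweight (k n : nat) (a : n.-tuple 'Z_k) : rat :=
  \sum_(i < n) @pseudoweight1 k (tnth a i).

Definition E_edges (k n : nat) : {set n.-tuple 'Z_k} :=
  [set a : n.-tuple 'Z_k | @pseudoweight k n a < (k * n)%:R / 2].

Definition H_edges (k n : nat) : {set n.-tuple 'Z_k} :=
  [set a : n.-tuple 'Z_k | @pseudoweight k n a == (k * n)%:R / 2].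

Definition is_period (k n : nat) (a : n.-tuple 'Z_k) (c : nat) : bool :=
  (0 < c)%N && [forall i : 'I_n, tnth a i == nth 0 a ((i + c) %% n)%N].

Lemma is_period_ex (k n : nat) (a : n.-tuple 'Z_k) :
  exists c, @is_period k n a c.
Proof.
exists (maxn 1 n); apply/andP; split; first by rewrite leq_max.
apply/forallP => i; have n_gt0 : (0 < n)%N by apply: leq_ltn_trans (ltn_ord i).
by rewrite (maxn_idPr n_gt0) modnDr modn_small // (tnth_nth 0).
Qed.

Definition period (k n : nat) (a : n.-tuple 'Z_k) : nat :=
  ex_minn (@is_period_ex k n a).

(* A circuit is represented by its set of edges. *)
Definition circuit (k n : nat) (a : n.-tuple 'Z_k) : {set n.-tuple 'Z_k} :=
  [set [tuple of rot j a] | j : 'I_(@period k n a)].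

Definition negasymmetric (k n : nat) (C : {set n.-tuple 'Z_k}) : bool :=
  [exists a in C, exists b in C, a == @negrev k n b].

Definition circuits (k n : nat) : {set {set n.-tuple 'Z_k}} :=
  [set @circuit k n a | a in H_edges k n].

Definition nonnegasym_circuits (k n : nat) : {set {set n.-tuple 'Z_k}} :=
  [set C in circuits k n | ~~ @negasymmetric k n C].

Definition rc_pairs (k n : nat) : {set {set {set n.-tuple 'Z_k}}} :=
  [set [set @circuit k n a; @circuit k n (@negrev k n a)]
    | a in [set a in H_edges k n | ~~ @negasymmetric k n (@circuit k n a)]].

Definition is_X (k n : nat) (X : {set n.-tuple 'Z_k}) : Prop :=
  exists S : {set {set n.-tuple 'Z_k}},
    [/\ S \subset nonnegasym_circuits k n,
        forall P, P \in rc_pairs k n -> #|S :&: P| = 1%N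
      & X = E_edges k n :|: cover S].

Definition antinegasymmetric (k n : nat) (X : {set n.-tuple 'Z_k}) : Prop :=
  forall a b, a \in X -> b \in X -> a <> @negrev k n b.

Definition nonzero_indeg (k n : nat) (X : {set n.-tuple 'Z_k}) :
    {set (n.-1).-tuple 'Z_k} :=
  [set v | indeg (@dB_tgt k n) X v != 0%N].

(* Main.v *)
Require Import Defs.
From mathcomp Require Import all_boot all_order all_algebra.
From mathcomp Require Import zify lra.

(** The map [a |-> -a^R] sends pseudoweight [w] to [kn - w], so two edges of
    [X] exchanged by it both have pseudoweight [kn/2]; they then lie on the
    chosen circuit of a single reverse-complementary pair, which would be
    negasymmetric.  The set [X] is closed under cyclic shifts, and the shift
    maps the edges entering a vertex bijectively onto those leaving it, which
    balances the degrees.  Finally 1 is the only entry of least pseudoweight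
    (as [k/2 > 1]), so in an edge of [X] the last entry may always be replaced
    by 1; alternating this with shifts leads from any vertex to [(1, ..., 1)]. *)

Set Implicit Arguments.
Unset Strict Implicit.
Unset Printing Implicit Defensive.

Import Order.TTheory GRing.Theory Num.Theory.
Local Open Scope ring_scope.

(** * Cyclic shifts and degree balance *)

Definition shift (T : Type) (n : nat) (a : n.-tuple T) : n.-tuple T :=
  [tuple of rot 1 a].

Lemma shift_inj (T : Type) (n : nat) : injective (@shift T n).
Proof. by move=> a b /(congr1 val) /= /rot_inj /val_inj. Qed.

Lemma iter_shift (T : Type) (n : nat) (a : n.-tuple T) (j : nat) :
  (j <= n)%N -> iter j (@shift T n) a = [tuple of rot j a].
Proof.
elim: j => [_|j IHj lt_jn]; apply: val_inj; first by rewrite /= rot0.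
by rewrite iterS IHj 1?ltnW //= -rotS ?size_tuple.
Qed.

Lemma dB_src_rcons (k n : nat) (v : n.-tuple 'Z_k) (x : 'Z_k) :
  dB_src [tuple of rcons v x] = v.
Proof.
apply: eq_from_tnth => i; rewrite tnth_mktuple !(tnth_nth 0) /=.
by rewrite nth_rcons size_tuple ltn_ord.
Qed.

Lemma rcons_dB_src (k n : nat) (a : n.+1.-tuple 'Z_k) :
  a = [tuple of rcons (dB_src a) (tnth a ord_max)].
Proof.
apply: eq_from_tnth => i; rewrite [RHS](tnth_nth 0) /= nth_rcons.
rewrite (size_tuple (dB_src a)) /=; case: ltnP => [lt_in | le_ni].
  rewrite -(tnth_nth 0 (dB_src a) (Ordinal lt_in)) tnth_mktuple.
  by congr tnth; apply: val_inj.
have ->: i = ord_max by apply: val_inj; apply/eqP; rewrite eqn_leq -ltnS ltn_ord.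
by rewrite eqxx.
Qed.

Lemma dB_src_shift (k n : nat) (a : n.-tuple 'Z_k) :
  dB_src (shift a) = dB_tgt a.
Proof.
case: n a => [|n] a; first by apply: eq_from_tnth => -[].
case/tupleP: a => x v.
suff ->: shift [tuple of x :: v] = [tuple of rcons v x].
  by rewrite dB_src_rcons; apply: val_inj.
by apply: val_inj; rewrite /= rot1_cons.
Qed.

Section ShiftClosedEdgeSets.
Variables (k n : nat) (X : {set n.-tuple 'Z_k}).
Hypothesis shiftX : forall a, (shift a \in X) = (a \in X).

Lemma indeg_eq_outdeg (v : n.-1.-tuple 'Z_k) :
  indeg (@dB_tgt k n) X v = outdeg (@dB_src k n) X v.
Proof.
rewrite /indeg -(card_imset _ (@shift_inj _ n)) /outdeg; congr #|pred_of_set _|.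
have [unshift _ unshiftK] := injF_bij (@shift_inj 'Z_k n).
(* Every edge is a shift of an edge, since an injection of a finite type is onto. Then the head of
   an edge is the tail of its shift. *)
apply/setP => b; rewrite -(unshiftK b) mem_imset ?inE; last exact: shift_inj.
by rewrite shiftX dB_src_shift.
Qed.

(** The vertex set is defined by in-degree alone; degree balance puts the tails of edges in it
    too. *)
Lemma dB_src_nonzero_indeg (a : n.-tuple 'Z_k) :
  a \in X -> dB_src a \in nonzero_indeg X.
Proof.
move=> aX; rewrite inE indeg_eq_outdeg -lt0n; apply/card_gt0P.
by exists a; rewrite inE aX eqxx.
Qed.

Lemma dB_tgt_nonzero_indeg (a : n.-tuple 'Z_k) :
  a \in X -> dB_tgt a \in nonzero_indeg X.
Proof. by rewrite -dB_src_shift -shiftX; apply: dB_src_nonzero_indeg. Qed.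

End ShiftClosedEdgeSets.

(** * Connectivity through a constant vertex *)

Lemma adjacent_sym (V E : finType) (src tgt : E -> V) (X : {set E}) :
  symmetric (adjacent src tgt X).
Proof. by move=> u v; apply: eq_existsb => e; rewrite orbC. Qed.

Lemma connected_of_replace_last (k n : nat) (x : 'Z_k) (X : {set n.+1.-tuple 'Z_k}) :
    (forall a, (shift a \in X) = (a \in X)) ->
    (forall (v : n.-tuple 'Z_k) y,
      [tuple of rcons v y] \in X -> [tuple of rcons v x] \in X) ->
  connected (@dB_src k n.+1) (@dB_tgt k n.+1) (nonzero_indeg X) X.
Proof.
move=> shiftX lastX.
pose adj := adjacent (@dB_src k n.+1) (@dB_tgt k n.+1) X.
(* One move: drop the first entry of [v] and append [x]. *)
pose next (v : n.-tuple 'Z_k) : n.-tuple 'Z_k := dB_tgt [tuple of rcons v x].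
have next_step v : v \in nonzero_indeg X ->
    adj v (next v) /\ next v \in nonzero_indeg X.
  rewrite {1}inE (indeg_eq_outdeg shiftX) -lt0n => /card_gt0P[a].
  rewrite inE => /andP[aX /eqP src_a].
  have eX : [tuple of rcons v x] \in X.
    by apply: (lastX _ (tnth a ord_max)); rewrite -src_a -rcons_dB_src.
  split; last exact: dB_tgt_nonzero_indeg.
  apply/existsP; exists [tuple of rcons v x].
  by rewrite eX /= [_ == v](introT eqP (dB_src_rcons v x)) eqxx.
have next_iter j v : v \in nonzero_indeg X ->
    connect adj v (iter j next v) /\ iter j next v \in nonzero_indeg X.
  move=> vW; elim: j => [|j [conj_v jW]]; first by split; first exact: connect0.
  have [stepj SjW] := next_step _ jW.
  by split=> //; apply: connect_trans conj_v (connect1 _).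
(* After [n] moves the original entries are all pushed out, leaving the constant vertex. *)
have val_iter j (v : n.-tuple 'Z_k) : (j <= n)%N ->
    iter j next v = drop j v ++ nseq j x :> seq _.
  elim: j => [|j IHj] ltjn; first by rewrite drop0 cats0.
  rewrite iterS /= IHj 1?ltnW // (drop_nth 0) ?size_tuple //=.
  by rewrite rcons_cat -cats1 -(nseqD j 1) addn1.
have to_const v : v \in nonzero_indeg X -> connect adj v [tuple of nseq n x].
  move=> /(next_iter n)[+ _]; congr (connect adj v _); apply: val_inj.
  by rewrite [LHS]val_iter // drop_oversize ?size_tuple.
(* Connectedness is undirected, so two paths into the constant vertex can be joined. *)
have adjC : connect_sym adj by apply/sym_connect_sym/adjacent_sym.
move=> u v uW vW; apply: connect_trans (to_const u uW) _.
by rewrite adjC to_const.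
Qed.

(** * Pseudoweights *)

Lemma pseudoweightE (k n : nat) (a : n.-tuple 'Z_k) :
  pseudoweight a = \sum_(x <- a) pseudoweight1 x.
Proof. by rewrite /pseudoweight big_tuple. Qed.

Lemma pseudoweight_shift (k n : nat) (a : n.-tuple 'Z_k) :
  pseudoweight (shift a) = pseudoweight a.
Proof.
by rewrite !pseudoweightE; apply: perm_big; rewrite /= perm_rot.
Qed.

Lemma pseudoweight_rcons (k n : nat) (v : n.-tuple 'Z_k) (x : 'Z_k) :
  pseudoweight [tuple of rcons v x] = pseudoweight v + pseudoweight1 x.
Proof. by rewrite !pseudoweightE /= -cats1 big_cat big_seq1. Qed.

(** The value [k/2] given to 0 is the fixed point of [w |-> k - w], so the rule for non-zero entries
    extends to 0. *)
Lemma pseudoweight1N (k : nat) (x : 'Z_k) :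
  (1 < k)%N -> pseudoweight1 (- x) = k%:R - pseudoweight1 x.
Proof.
case: k x => [|[|k]] // x _; rewrite /pseudoweight1 oppr_eq0.
case: eqVneq => [_|x_neq0]; first by lra.
have x_gt0 : (0 < x)%N by rewrite lt0n.
rewrite /= modn_small; last by rewrite ltn_subrL x_gt0.
by rewrite natrB // ltnW // ltn_ord.
Qed.

Lemma pseudoweight_negrev (k n : nat) (a : n.-tuple 'Z_k) :
  (1 < k)%N -> pseudoweight (negrev a) = (k * n)%:R - pseudoweight a.
Proof.
move=> k_gt1; rewrite !pseudoweightE big_map.
under eq_bigr => x _ do rewrite pseudoweight1N //.
rewrite (perm_big a) /= ?perm_rev // sumrB big_const_seq count_predT size_tuple.
by rewrite iter_addr_0 natrM mulr_natr.
Qed.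

Lemma pseudoweight1_gt1 (k : nat) (x : 'Z_k) :
  (2 < k)%N -> x != 1 -> @pseudoweight1 k 1 < pseudoweight1 x.
Proof.
move=> k_gt2 x_neq1.
have val1 : (1 : 'Z_k) = 1%N :> nat by case: k k_gt2 {x x_neq1} => [|[|[]]].
rewrite /pseudoweight1 oner_eq0 val1; case: eqVneq => [_|x_neq0].
  have k_ge3 : 3 <= k%:R :> rat by rewrite ler_nat.
  lra.
rewrite ltr_nat ltn_neqAle lt0n x_neq0 andbT eq_sym.
by apply: contra_neq x_neq1 => x1; apply: val_inj; rewrite [LHS]x1 [RHS]val1.
Qed.

Lemma shift_E_edges (k n : nat) (a : n.-tuple 'Z_k) :
  (shift a \in E_edges k n) = (a \in E_edges k n).
Proof. by rewrite !inE pseudoweight_shift. Qed.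

Lemma shift_H_edges (k n : nat) (a : n.-tuple 'Z_k) :
  (shift a \in H_edges k n) = (a \in H_edges k n).
Proof. by rewrite !inE pseudoweight_shift. Qed.

(** * Circuits as orbits of the shift *)

Lemma period_leq (k n : nat) (a : n.-tuple 'Z_k) : (0 < n)%N -> (period a <= n)%N.
Proof.
move=> n_gt0; rewrite /period; case: ex_minnP => m _; apply.
rewrite /is_period n_gt0; apply/forallP => i.
by rewrite modnDr modn_small // (tnth_nth 0).
Qed.

Lemma iter_period_shift (k n : nat) (a : n.-tuple 'Z_k) :
  (0 < n)%N -> iter (period a) (@shift _ n) a = a.
Proof.
move=> n_gt0; rewrite iter_shift ?period_leq //.
have : is_period a (period a) by rewrite /period; case: ex_minnP.
case/andP=> _ /forallP pa; apply: eq_from_tnth => i.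
rewrite (eqP (pa i)) (tnth_nth 0) /= /rot.
have le_pn := period_leq a n_gt0.
rewrite nth_cat size_drop size_tuple nth_drop.
(* The cases are whether [i + period a] stays below [n] or wraps around; as the period is at most
   [n], it wraps at most once. *)
case: ltnP => [lt_i | le_i].
  by rewrite addnC modn_small // addnC -ltn_subRL.
have lt_in := ltn_ord i.
have le_n : (n <= i + period a)%N by lia.
rewrite nth_take; last by lia.
rewrite -(subnK le_n) modnDr modn_small; last by lia.
by congr nth; lia.
Qed.

(** As orbits of an injective map, circuits sharing an edge coincide. *)
Lemma circuitE (k n : nat) (a : n.-tuple 'Z_k) :
  (0 < n)%N -> circuit a = [set b | fconnect (@shift _ n) a b].
Proof.
move=> n_gt0; have le_pn := period_leq a n_gt0.
apply/setP => b; rewrite inE; apply/imsetP/idP => [[j _ ->] | /iter_findex <-].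
  by rewrite -iter_shift ?fconnect_iter // ltnW // (leq_trans (ltn_ord j)).
set j := findex _ _ _.
have p_gt0 : (0 < period a)%N by rewrite /period; case: ex_minnP => m /andP[].
(* The orbit index [j] may be any number; it is reduced modulo the period, whose multiples fix
   [a]. *)
have lt_jp : (j %% period a < period a)%N by rewrite ltn_mod.
exists (Ordinal lt_jp) => //=.
rewrite -iter_shift; last by rewrite ltnW // (leq_trans lt_jp).
rewrite {1}(divn_eq j (period a)) addnC iterD; congr iter.
by elim: (j %/ _)%N => // q IHq; rewrite mulSn iterD IHq iter_period_shift.
Qed.

Lemma circuit_refl (k n : nat) (a : n.-tuple 'Z_k) : (0 < n)%N -> a \in circuit a.
Proof. by move=> n_gt0; rewrite circuitE // inE connect0. Qed.

Lemma circuit_eq (k n : nat) (a b : n.-tuple 'Z_k) :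
  (0 < n)%N -> b \in circuit a -> circuit b = circuit a.
Proof.
move=> n_gt0; rewrite !circuitE // inE => ab.
apply/setP => c; rewrite !inE; apply/esym/same_connect => //.
exact/fconnect_sym/shift_inj.
Qed.

Lemma shift_circuit (k n : nat) (a b : n.-tuple 'Z_k) :
  (0 < n)%N -> (shift b \in circuit a) = (b \in circuit a).
Proof.
move=> n_gt0; rewrite circuitE // !inE.
by rewrite -(same_fconnect1_r (@shift_inj _ n)).
Qed.

Lemma circuit_sub_H_edges (k n : nat) (a : n.-tuple 'Z_k) :
  (0 < n)%N -> a \in H_edges k n -> circuit a \subset H_edges k n.
Proof.
move=> n_gt0 aH; apply/subsetP => b; rewrite circuitE // inE => /iter_findex <-.
by elim: findex => //= j; rewrite shift_H_edges.
Qed.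

Lemma nonnegasym_circuitP (k n : nat) (C : {set n.-tuple 'Z_k}) (a : n.-tuple 'Z_k) :
    (0 < n)%N -> C \in nonnegasym_circuits k n -> a \in C ->
  [/\ a \in H_edges k n, C = circuit a & ~~ negasymmetric C].
Proof.
move=> n_gt0; rewrite inE => /andP[/imsetP[c cH ->] nnC] ac.
split=> //; last by rewrite (circuit_eq n_gt0 ac).
by apply: subsetP ac; apply: circuit_sub_H_edges.
Qed.

(** * The set of chosen edges *)

Section ChosenEdges.
Variables (k n : nat) (S : {set {set n.-tuple 'Z_k}}).
Hypotheses (k_gt2 : (2 < k)%N) (n_gt0 : (0 < n)%N).
Hypothesis S_sub : S \subset nonnegasym_circuits k n.
Local Notation X := (E_edges k n :|: cover S).

Lemma cover_chosenP (a : n.-tuple 'Z_k) :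
  a \in cover S -> [/\ a \in H_edges k n, circuit a \in S & ~~ negasymmetric (circuit a)].
Proof.
case/bigcupP=> C CS aC.
have [aH defC nnC] := nonnegasym_circuitP n_gt0 (subsetP S_sub C CS) aC.
by rewrite -defC.
Qed.

Lemma shift_chosen (a : n.-tuple 'Z_k) : (shift a \in X) = (a \in X).
Proof.
rewrite !in_setU shift_E_edges; congr orb.
apply/bigcupP/bigcupP => -[C CS aC]; exists C => //; move: aC;
  have /setIdP[/imsetP[c _ ->] _] := subsetP S_sub C CS; by rewrite shift_circuit.
Qed.

Lemma chosen_pseudoweight_le (a : n.-tuple 'Z_k) :
  a \in X -> pseudoweight a <= (k * n)%:R / 2.
Proof.
rewrite inE => /orP[|/cover_chosenP[+ _ _]]; rewrite inE; first exact: ltW.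
by move/eqP->.
Qed.

(** A strict drop below [kn/2] lands in [E_edges], whichever circuits were chosen. *)
Lemma chosen_of_pseudoweight_lt (a b : n.-tuple 'Z_k) :
  b \in X -> pseudoweight a < pseudoweight b -> a \in X.
Proof.
move=> /chosen_pseudoweight_le le_b lt_ab.
by rewrite !inE (lt_le_trans lt_ab le_b).
Qed.

Lemma antinegasymmetric_chosen :
    (forall P, P \in rc_pairs k n -> #|S :&: P| = 1%N) ->
  antinegasymmetric X.
Proof.
move=> S_pairs a b aX bX def_a.
have wa : pseudoweight a = (k * n)%:R - pseudoweight b.
  by rewrite def_a pseudoweight_negrev // ltnW.
have le_a := chosen_pseudoweight_le aX; have le_b := chosen_pseudoweight_le bX.
(* The weights of [a] and [b] sum to [kn] and neither exceeds [kn/2], so both equal it and neither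
   edge is in [E_edges]. *)
have in_cover c : c \in X -> (k * n)%:R / 2 <= pseudoweight c -> c \in cover S.
  by rewrite in_setU inE ltNge => /orP[/negbTE-> | ].
have /cover_chosenP[_ aS _] : a \in cover S by apply: in_cover => //; lra.
have /cover_chosenP[bH bS nnb] : b \in cover S by apply: in_cover => //; lra.
have /S_pairs/eqP : [set circuit b; circuit a] \in rc_pairs k n.
  by apply/imsetP; exists b; rewrite ?def_a // inE bH.
case/cards1P=> C defC.
have inC c : c \in S -> c \in [set circuit b; circuit a] -> c = C.
  by move=> cS cP; apply/set1P; rewrite -defC inE cS.
(* Both circuits of the pair are in [S], which meets the pair only in [C]. *)
have eq_ab : circuit a = circuit b.
  by transitivity C; [|symmetry]; apply: inC; rewrite // in_set2 eqxx ?orbT.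
case/negP: nnb; apply/existsP; exists a; rewrite -{1}eq_ab circuit_refl //=.
by apply/existsP; exists b; rewrite circuit_refl // def_a eqxx.
Qed.

End ChosenEdges.

Theorem theorem3p1 (k n : nat) (hk : (3 <= k)%N) (hn : (3 <= n)%N)
    (X : {set n.-tuple 'Z_k}) (hX : @is_X k n X) :
  Eulerian (@dB_src k n) (@dB_tgt k n) (@nonzero_indeg k n X) X
  /\ @antinegasymmetric k n X.
Proof.
have n_gt0 : (0 < n)%N by apply: leq_trans hn.
case: hX => S [S_sub S_pairs ->].
split; last exact: antinegasymmetric_chosen.
have shiftX := shift_chosen n_gt0 S_sub.
split=> [a aX | | v _]; last exact: indeg_eq_outdeg.
  by rewrite dB_src_nonzero_indeg ?dB_tgt_nonzero_indeg.
(* With [n] a successor, an edge can be written as [rcons v y] with [v] its tail. *)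
case: n n_gt0 {hn X} S S_sub {S_pairs} shiftX => // n n_gt0 S S_sub shiftX.
apply: (connected_of_replace_last (x := 1)) => // v y vyX.
have [<- // | y_neq1] := eqVneq y 1.
apply: chosen_of_pseudoweight_lt vyX _ => //.
by rewrite !pseudoweight_rcons ltrD2l pseudoweight1_gt1.
Qed.
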